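(* Let $\Sigma$ be the ensemble system $$\frac{d}{dt}x(t,\beta)=F(x(t,\beta),\beta,u(t)),\qquad Y_t=h(x_t(\Omega)),\qquad \beta\in\Omega,$$ with state space $\mathcal{F}(\Omega,M)$, output function $h:M\to N$ and output measures $\mu_t=(h\circ x_t)_\#\lambda\in\mathcal{P}(N)$. Equip $\mathcal{F}(\Omega,M)$ with the metric $$d_F(f_1,f_2)=\int_\Omega \frac{\rho(f_1(\beta),f_2(\beta))}{1+\rho(f_1(\beta),f_2(\beta))}\,d\lambda(\beta),$$ where $\rho$ is the Riemannian distance on $M$. Equip $\mathcal{P}(N)$ with a metric $d_P$ metrizing the weak topology. Assume that $\Sigma$ is ensemble controllable on $(\mathcal{F}(\Omega,M),d_F)$ and that $h:M\to N$ is continuous and surjective. Then $\Sigma$ is pattern controllable on $(\mathcal{P}(N),d_P)$.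
   Context: Standing setup. - $\Omega\subset\mathbb{R}^d$ is compact, and $\lambda$ is an atomless Borel probability measure on $\Omega$. - $M$ is a Riemannian manifold and $N$ is a Polish metric space. - Controls are measurable functions $u:[0,T]\to\mathbb{R}^p$, and the same control is applied to every $\beta\in\Omega$. - $\mathcal{F}(\Omega,M)$ denotes the space of Borel measurable maps $\Omega\to M$. For each $t$, $x_t=x(t,\cdot)\in\mathcal{F}(\Omega,M)$. - $\mathcal{P}(N)$ denotes the space of Borel probability measures on $N$. The output measure at time $t$ is the pushforward $\mu_t=(y_t)_\#\lambda$, where $y_t(\beta)=h(x_t(\beta))$; that is, $\mu_t(B)=\lambda(y_t^{-1}(B))$ for Borel $B\subseteq N$. Ensemble controllability on $\mathcal{F}(\Omega,M)$ with respect to a metric $d_F$: for every initial state $x_0\in\mathcal{F}(\Omega,M)$, every target $x_F\in\mathcal{F}(\Omega,M)$ and every $\varepsilon>0$, there exist a finite time $T>0$ and a measurable control $u$ such that the solution satisfies $d_F(x_T,x_F)<\varepsilon$. Pattern controllability on $\mathcal{P}(N)$ with respect to $d_P$: for every initial state (inducing the initial output measure $\mu_0$), every target $\mu_F\in\mathcal{P}(N)$ and every $\varepsilon>0$, there exist a finite $T>0$ and a measurable control $u$ such that $d_P(\mu_T,\mu_F)<\varepsilon$. *)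

(* Defs.v *)
From HB Require Import structures.
From mathcomp Require Import all_boot all_order all_algebra.
From mathcomp Require Import all_classical all_reals all_analysis.
Set Implicit Arguments. Unset Strict Implicit. Unset Printing Implicit Defensive.
Import Order.TTheory GRing.Theory Num.Theory.
Import numFieldNormedType.Exports.
Local Open Scope classical_set_scope.
Local Open Scope ring_scope.

Notation borel T := (g_sigma_algebraType (@open T)).

(** Polish metric space: a (pointed) pseudometric space that is Hausdorff
    (hence a genuine metric space), separable and complete. *)
Definition polish_metric {R : realType} (N : pseudoPMetricType R) : Prop :=
  hausdorff_space N /\
  (exists D : set N, countable D /\ closure D = setT) /\
  (forall u : nat -> N, cauchy (u @ \oo) -> exists l : N, u @ \oo --> l).

(** sigma-compactness (every Riemannian manifold is sigma-compact) *)
Definition sigma_compact (T : topologicalType) : Prop :=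
  exists K : nat -> set T, (forall n, compact (K n)) /\ \bigcup_n K n = setT.

Definition atomless d (T : measurableType d) {R : realType}
  (mu : set T -> \bar R) : Prop :=
  forall A : set T, measurable A -> (0 < mu A)%E ->
    exists B : set T, [/\ measurable B, B `<=` A & (0 < mu B < mu A)%E].

Definition is_prob {R : realType} (N : ptopologicalType)
  (mu : set (borel N) -> \bar R) : Prop :=
  [/\ mu set0 = 0%E, (forall A : set (borel N), measurable A -> (0 <= mu A)%E),
      semi_sigma_additive mu & mu setT = 1%E].

Definition bounded_fun {R : realType} (N : ptopologicalType) (f : N -> R) :=
  exists C : R, forall y, `|f y| <= C.

Definition weak_open {R : realType} (N : ptopologicalType)
  (U : set (set (borel N) -> \bar R)) : Prop :=
  forall mu, is_prob mu -> U mu ->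
    exists (n : nat) (fs : 'I_n -> N -> R) (e : R),
      [/\ 0 < e,
          (forall i, continuous (fs i) /\ bounded_fun (fs i)) &
          (forall nu, is_prob nu ->
             (forall i, (`| \int[nu]_(y in setT) ((fs i y)%:E : \bar R)
                        - \int[mu]_(y in setT) ((fs i y)%:E : \bar R) | < e%:E)%E)
             -> U nu)].

Definition dP_open {R : realType} (N : ptopologicalType)
  (dP : (set (borel N) -> \bar R) -> (set (borel N) -> \bar R) -> R)
  (U : set (set (borel N) -> \bar R)) : Prop :=
  forall mu, U mu -> exists r : R, 0 < r /\
    forall nu, is_prob nu -> dP mu nu < r -> U nu.

(** dP is a metric on P(N) (two probability measures being identified when
    they agree on the Borel sets) metrizing the weak topology. *)
Definition metrizes_weak {R : realType} (N : ptopologicalType)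
  (dP : (set (borel N) -> \bar R) -> (set (borel N) -> \bar R) -> R) : Prop :=
  [/\ (forall mu nu, is_prob mu -> is_prob nu -> 0 <= dP mu nu),
      (forall mu, is_prob mu -> dP mu mu = 0),
      (forall mu nu, is_prob mu -> is_prob nu -> dP mu nu = 0 ->
          forall B : set (borel N), measurable B -> mu B = nu B),
      (forall mu nu, is_prob mu -> is_prob nu -> dP mu nu = dP nu mu) &
      (forall mu nu xi, is_prob mu -> is_prob nu -> is_prob xi ->
          dP mu xi <= dP mu nu + dP nu xi)] /\
      (forall U, U `<=` @is_prob R N -> (weak_open U <-> dP_open dP U)).

Definition dF {R : realType} {d : nat} (M : metricType R)
  (lam : set (borel 'rV[R]_d) -> \bar R) (Om : set 'rV[R]_d)
  (f1 f2 : 'rV[R]_d -> M) : \bar R :=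
  (\int[lam]_(b in (Om : set (borel 'rV[R]_d)))
     ((mdist (f1 b) (f2 b) / (1 + mdist (f1 b) (f2 b)))%:E))%E.

Definition output_measure {R : realType} {d : nat} (M : topologicalType) (N : ptopologicalType)
  (lam : set (borel 'rV[R]_d) -> \bar R) (Om : set 'rV[R]_d)
  (h : M -> N) (x : 'rV[R]_d -> M) : set (borel N) -> \bar R :=
  fun B => lam (Om `&` (h \o x) @^-1` B).

(** (a map is Borel measurable iff the preimage of every open set is a Borel set) *)
Definition state_meas {R : realType} {d : nat} (M : topologicalType)
  (Om : set 'rV[R]_d) (x : 'rV[R]_d -> M) : Prop :=
  forall U : set M, open U ->
    measurable ((Om `&` x @^-1` U) : set (borel 'rV[R]_d)).

Definition control_meas {R : realType} {p : nat} (T : R) (u : R -> 'rV[R]_p) : Prop :=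
  measurable_fun `[0, T] (u : R -> borel 'rV[R]_p).

(** The ensemble system is given abstractly through its solution map:
    [sol x0 u T] is the state x_T in F(Omega,M) reached at time T from x0
    under control u. *)
Definition ensemble_controllable {R : realType} {d p : nat} (M : metricType R)
  (lam : set (borel 'rV[R]_d) -> \bar R) (Om : set 'rV[R]_d)
  (sol : ('rV[R]_d -> M) -> (R -> 'rV[R]_p) -> R -> ('rV[R]_d -> M)) : Prop :=
  forall x0 xF : 'rV[R]_d -> M, state_meas Om x0 -> state_meas Om xF ->
  forall eps : R, 0 < eps ->
  exists T : R, exists u : R -> 'rV[R]_p,
    [/\ 0 < T, control_meas T u & (dF lam Om (sol x0 u T) xF < eps%:E)%E].

Definition pattern_controllable {R : realType} {d p : nat} (M : topologicalType) (N : ptopologicalType)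
  (lam : set (borel 'rV[R]_d) -> \bar R) (Om : set 'rV[R]_d) (h : M -> N)
  (dP : (set (borel N) -> \bar R) -> (set (borel N) -> \bar R) -> R)
  (sol : ('rV[R]_d -> M) -> (R -> 'rV[R]_p) -> R -> ('rV[R]_d -> M)) : Prop :=
  forall x0 : 'rV[R]_d -> M, state_meas Om x0 ->
  forall muF, is_prob muF ->
  forall eps : R, 0 < eps ->
  exists T : R, exists u : R -> 'rV[R]_p,
    [/\ 0 < T, control_meas T u &
        dP (output_measure lam Om h (sol x0 u T)) muF < eps].

(* Main.v *)
(** A weak neighbourhood of [muF] only tests finitely many bounded continuous
    functions [f i].  Cut [N] into finitely many Borel cells on which every
    [f i] is almost constant; since [lam] is atomless, [Om] can be cut into
    pieces whose masses are those of the cells, and a state sending each piece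
    to an [h]-preimage of a point of its cell nearly reproduces the integrals of
    the [f i] against [muF].  This target takes finitely many values, so the
    [f i \o h] have a common modulus of continuity at them; by Markov's
    inequality a state close to the target for [dF] is pointwise close to it off
    a set of small mass, hence its output measure lies in the neighbourhood. *)

Require Import Defs.
From HB Require Import structures.
From mathcomp Require Import all_boot all_order all_algebra.
From mathcomp Require Import all_classical all_reals all_analysis.
From mathcomp Require Import measurable_realfun lra.
Import Order.TTheory GRing.Theory Num.Theory.
Import numFieldNormedType.Exports.
Local Open Scope classical_set_scope.
Local Open Scope ring_scope.

Set Implicit Arguments.
Unset Strict Implicit.
Unset Printing Implicit Defensive.

(** * Atomless probabilities: subsets and partitions of prescribed mass *)

Section atomless_probability.
Context (d : measure_display) (T : measurableType d) (R : realType).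
Variable P : probability T R.
Implicit Types A B C : set T.

Let pr A : R := fine (P A).

Let prE A : measurable A -> P A = (pr A)%:E.
Proof. by move=> mA; rewrite /pr fineK// fin_num_measure. Qed.

Let pr_ge0 A : 0 <= pr A.
Proof. by rewrite /pr fine_ge0. Qed.

Let pr0 : pr set0 = 0.
Proof. by rewrite /pr measure0. Qed.

Let le_pr A B : measurable A -> measurable B -> A `<=` B -> pr A <= pr B.
Proof. by move=> mA mB AB; rewrite -lee_fin -!prE// le_measure// inE. Qed.

Let prD A B : measurable A -> measurable B -> B `<=` A ->
  pr (A `\` B) = pr A - pr B.
Proof.
move=> mA mB BA; apply: EFin_inj; rewrite -prE; last exact: measurableD.
rewrite measureD//; last by rewrite ltey_eq fin_num_measure.
by rewrite (setIidr BA) EFinB -!prE.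
Qed.

Let prU A B : measurable A -> measurable B -> A `&` B = set0 ->
  pr (A `|` B) = pr A + pr B.
Proof.
move=> mA mB AB; apply: EFin_inj; rewrite -prE; last exact: measurableU.
by rewrite measureU// EFinD -!prE.
Qed.

(** Repeated halving: when [C] splits [B] properly, one of [C] and [B \ C] has positive mass at most
    half that of [B], so [n] rounds leave mass at most [2^-n]. *)
Lemma atomless_small_subset A (e : R) : atomless P -> measurable A ->
  (0 < P A)%E -> 0 < e ->
  exists B, [/\ measurable B, B `<=` A & (0 < P B <= e%:E)%E].
Proof.
move=> atP mA PA0 e0.
have half n : exists B, [/\ measurable B, B `<=` A & 0 < pr B <= 2^-1 ^+ n].
  elim: n => [|n [B [mB BA /andP[B0 Bn]]]].
    exists A; split=> //; rewrite expr0 -!lte_fin -!lee_fin -prE//.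
    by rewrite PA0 probability_le1.
  have [||C [mC CB]] := atP B; rewrite ?prE// ?lte_fin//.
  move=> /andP[C0 CBlt].
  have [le2|lt2] := leP (pr C) (pr B / 2).
    exists C; split=> //; first exact: subset_trans BA.
    rewrite C0/= (le_trans le2)// exprSr ler_pM2r//.
  exists (B `\` C); split; [exact: measurableD| |].
    by move=> x [/BA].
  rewrite prD// subr_gt0 CBlt/= exprSr.
  lra.
have [n en] : exists n, 2^-1 ^+ n < e.
  have /cvgrPdist_lt /(_ _ e0) [n _ /(_ n (leqnn n))] :
      (fun n => (2^-1 : R) ^+ n) @ \oo --> (0 : R).
    by apply: cvg_expr; rewrite ger0_norm ?invr_ge0// invf_lt1// ltr1n.
  rewrite /= sub0r normrN ger0_norm ?exprn_ge0// => h.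
  by exists n.
have [B [mB BA /andP[B0 Bn]]] := half n.
exists B; split=> //; rewrite prE// lte_fin B0 lee_fin.
by rewrite (le_trans Bn)// ltW.
Qed.

(** Sierpinski's intermediate value theorem for atomless measures, obtained by exhausting [A] from
    inside without ever exceeding mass [w]. *)
Lemma atomless_intermediate A (w : R) : atomless P -> measurable A ->
  0 <= w -> (w%:E <= P A)%E ->
  exists B, [/\ measurable B, B `<=` A & P B = w%:E].
Proof.
move=> atP mA w0; rewrite prE// lee_fin => wA.
pose good B := [/\ measurable B, B `<=` A & pr B <= w].
(* Greedy choice: [C] gains at least half of what is still possible, so in the
   limit no set of positive mass can be added. *)
have step B : exists C, good B -> [/\ good C, B `<=` C &
    forall D, measurable D -> D `<=` A `\` B -> pr D <= w - pr B ->
    pr D <= 2 * (pr C - pr B)].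
  have [gB|] := pselect (good B); last by move=> nB; exists B.
  have [mB BA Bw] := gB.
  pose S := [set r | exists D, [/\ measurable D, D `<=` A `\` B,
    pr D <= w - pr B & pr D = r]].
  have S0 : S 0.
    by exists set0; rewrite pr0 subr_ge0; split => //; exact: sub0set.
  have hS : has_sup S.
    split; first by exists 0.
    by exists (w - pr B) => r [D [_ _ + <-]].
  have leS r : S r -> r <= sup S by move=> Sr; exact: ub_le_sup hS.2 _ Sr.
  (* If the supremum is 0, no admissible set has positive mass and [B] is kept; otherwise some
     admissible [C] exceeds half of it. *)
  have [s0|s0] := leP (sup S) 0.
    exists B => _; split => // D mD DAB DB; rewrite subrr mulr0.
    by rewrite (le_trans _ s0)// leS//; exists D.
  have [r [C [mC CAB CB Cr]] ltr] := sup_adherent (divr_gt0 s0 (@ltr0Sn _ 1)) hS.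
  have BC0 : B `&` C = set0.
    by rewrite -subset0 => x [Bx /CAB[_]].
  exists (B `|` C) => _; split; last first.
  - move=> D mD DAB DB; rewrite prU// addrAC subrr add0r.
    have : pr D <= sup S by apply: leS; exists D.
    rewrite Cr; lra.
  - by move=> x; left.
  split; first exact: measurableU.
    by move=> x [/BA//|/CAB[]].
  by rewrite prU//; lra.
have [next nextP] := choice step.
pose F n := iter n next set0.
have gF n : good (F n).
  elim: n => [|n ih]; last by have [] := nextP _ ih.
  by split; [exact: measurable0|exact: sub0set|rewrite pr0].
have FS n : F n `<=` F n.+1 by have [] := nextP _ (gF n).
have mF n : measurable (F n) by have [] := gF n.
have mU : measurable (\bigcup_n F n) by exact: bigcup_measurable.
have UA : \bigcup_n F n `<=` A by move=> x [n _]; have [_ + _] := gF n; apply.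
exists (\bigcup_n F n); split => //.
have Uw : pr (\bigcup_n F n) <= w.
  rewrite -lee_fin -prE//.
  have ndF : {homo F : n m / (n <= m)%N >-> (n <= m)%O}.
    by apply/nondecreasing_seqP => n; apply/subsetPset.
  have cF := @nondecreasing_cvg_mu _ _ _ P _ mF mU ndF.
  rewrite -(cvg_lim _ cF)//; apply: lime_le; first by apply/cvg_ex; eexists; exact: cF.
  by apply: nearW => n /=; rewrite prE// lee_fin; have [] := gF n.
(* If the union fell short of [w], a set [D] of small positive mass in the remainder would be
   admissible at every stage. Each stage would then gain at least [pr D / 2], and the masses,
   bounded by [w], would grow without limit. *)
apply/eqP; rewrite prE// eqe eq_le Uw/= leNgt; apply/negP => ltw.
have [|||D [mD DAU /andP[D0 Dw]]] :=
  @atomless_small_subset (A `\` \bigcup_n F n) (w - pr (\bigcup_n F n)) atP.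
- exact: measurableD.
- by rewrite prE ?lte_fin ?prD// ?subr_gt0; [exact: lt_le_trans wA|exact: measurableD].
- by rewrite subr_gt0.
move: D0 Dw; rewrite prE// lte_fin lee_fin => D0 Dw.
have gain n : pr D / 2 <= pr (F n.+1) - pr (F n).
  have [_ _ /(_ D mD)] := nextP _ (gF n).
  have FU : F n `<=` \bigcup_n F n by exact: bigcup_sup.
  have leU : pr (F n) <= pr (\bigcup_n F n) by exact: le_pr.
  have DF : D `<=` A `\` F n by move=> x /DAU[Ax nUx]; split => // /FU.
  move=> /(_ DF); lra.
have grow n : n%:R * (pr D / 2) <= pr (F n).
  elim: n => [|n ih]; first by rewrite mul0r.
  by rewrite -natr1 mulrDl mul1r; have := gain n; lra.
have := @archi_boundP R (w / (pr D / 2)).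
rewrite divr_ge0// ?divr_ge0// => /(_ isT).
rewrite ltr_pdivrMr ?divr_gt0//.
set n := Num.bound _ => ltwn.
by have := grow n; have [_ _] := gF n; lra.
Qed.

End atomless_probability.

(** Induction on [s]: a piece of mass [w j] is cut off for each [j] in [s], and [i0] receives what
    is left. Setting [i0] apart provides a value for the total map [c] in the base case; [uniq]
    ensures that no later cut reuses the colour [j]. *)
Lemma atomless_partition_seq (d : measure_display) (T : measurableType d)
    (R : realType) (P : probability T R) (I : eqType) (w : I -> R) (i0 : I)
    (s : seq I) (A : set T) :
  atomless P -> measurable A -> (forall i, 0 <= w i) -> uniq (i0 :: s) ->
  P A = (\sum_(i <- i0 :: s) w i)%:E ->
  exists c : T -> I, [/\ forall t, c t \in i0 :: s,
    forall i, measurable (A `&` c @^-1` [set i]) &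
    forall i, i \in i0 :: s -> P (A `&` c @^-1` [set i]) = (w i)%:E].
Proof.
move=> atP + w0; elim: s A => [|j s ih] A mA.
  rewrite big_seq1 => _ PA; exists (fun=> i0); split=> [t|i|i].
  - by rewrite mem_head.
  - rewrite preimage_cst; case: ifP => _; rewrite ?setIT// setI0.
    exact: measurable0.
  - by rewrite inE => /eqP ->; rewrite preimage_cst mem_set// setIT.
rewrite /= inE negb_or => /andP[/andP[i0j i0s] /andP[js us]].
rewrite !big_cons => PA.
have s0 : 0 <= \sum_(i <- s) w i by apply: sumr_ge0.
have [|B [mB BA PB]] := @atomless_intermediate _ _ _ P A (w j) atP mA (w0 j).
  by rewrite PA lee_fin addrCA lerDl addr_ge0.
have [|||c [cs mc Pc]] := ih (A `\` B); first exact: measurableD.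
- by rewrite /= i0s us.
- have -> : P (A `\` B) = (P A - P B)%E.
    by rewrite measureD// ?(setIidr BA)// ltey_eq fin_num_measure.
  by rewrite PA PB -EFinB big_cons; congr EFin; lra.
pose c' t := if t \in B then j else c t.
have cNj t : c t <> j.
  move=> ctj; have := cs t; rewrite ctj inE (negbTE js) orbF => /eqP ji0.
  by rewrite ji0 eqxx in i0j.
have cj : A `&` c' @^-1` [set j] = B.
  apply/seteqP; split=> t /=.
    by case=> _; rewrite /c'; case: ifPn => [/set_mem//|_ /cNj].
  by move=> Bt; split; [exact: BA|rewrite /c' mem_set].
have ci i : i != j ->
    A `&` c' @^-1` [set i] = (A `\` B) `&` c @^-1` [set i].
  move=> ij; apply/seteqP; split=> t /=; rewrite /c'.
    case=> At; case: ifPn => [_ ji|]; first by rewrite ji eqxx in ij.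
    by rewrite notin_setE.
  by move=> [[At Bt] cti]; split => //; rewrite memNset.
exists c'; split=> [t|i|i].
- rewrite /c'; case: ifPn => _; first by rewrite !inE eqxx orbT.
  by have := cs t; rewrite !inE => /orP[->//|->]; rewrite !orbT.
- by have [->|/ci ->//] := eqVneq i j; rewrite cj.
- have [->|ij] := eqVneq i j; first by rewrite cj.
  by rewrite ci// !inE (negbTE ij)/= => ?; rewrite Pc// inE.
Qed.

Lemma atomless_partition (d : measure_display) (T : measurableType d)
    (R : realType) (P : probability T R) (I : finType) (w : I -> R) :
  atomless P -> (forall i, 0 <= w i) -> \sum_i w i = 1 ->
  exists c : T -> I, forall i,
    measurable (c @^-1` [set i]) /\ P (c @^-1` [set i]) = (w i)%:E.
Proof.
move=> atP w0 w1.
have := enum_uniq I; have := mem_enum I; move: w1; rewrite -big_enum/=.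
case: (enum I) => [|i0 s] sw1 sI us.
  by move: sw1; rewrite big_nil => /eqP; rewrite eq_sym oner_eq0.
have PT : P setT = (\sum_(i <- i0 :: s) w i)%:E by rewrite probability_setT sw1.
have [c [_ mc Pc]] :=
  @atomless_partition_seq _ _ _ P I w i0 s setT atP measurableT w0 us PT.
exists c => i; have := mc i; have := Pc i; rewrite setTI => Pci mci.
by split => //; rewrite Pci// sI.
Qed.

(** * Functions glued along a finite measurable partition *)

Section finitely_valued.
Context (d : measure_display) (T : measurableType d) (I : finType).
Variable c : T -> I.
Hypothesis mc : forall i, measurable (c @^-1` [set i]).

Lemma measurable_preimage_fin (C : I -> set T) :
  (forall i, measurable (C i)) -> measurable [set t | C (c t) t].
Proof.
move=> mC.
rewrite (_ : [set _ | _] = \bigcup_(i in [set: I]) (c @^-1` [set i] `&` C i)).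
  apply: fin_bigcup_measurable => // i _; exact: measurableI.
apply/seteqP; split=> t /=; first by move=> ?; exists (c t).
by case=> i _ [/= ->].
Qed.

Lemma measurable_fun_fin (d' : measure_display) (U : measurableType d')
    (f : I -> T -> U) :
  (forall i, measurable_fun setT (f i)) ->
  measurable_fun setT (fun t => f (c t) t).
Proof.
move=> mf _ B mB; rewrite setTI.
apply: (@measurable_preimage_fin (fun i => f i @^-1` B)) => i.
by rewrite -[X in measurable X]setTI; apply: mf.
Qed.

Lemma Rintegral_fin (R : realType) (P : probability T R) (phi : I -> R) :
  \int[P]_t phi (c t) = \sum_i phi i * fine (P (c @^-1` [set i])).
Proof.
rewrite /Rintegral.
under eq_integral => t _.
  rewrite (_ : (phi (c t))%:E =
    \sum_i (phi i)%:E * (\1_(c @^-1` [set i]) t)%:E)%E; last first.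
    rewrite (bigD1 (c t))//= indicE mem_set//= mule1 big1 ?adde0// => i ict.
    by rewrite indicE memNset ?mule0//= => /esym/eqP; exact/negP.
  over.
rewrite integral_sum//; last first.
  move=> i; apply: integrableZl => //.
  exact: integrable_indic.
under eq_bigr => i _.
  rewrite integralZl//; last exact: integrable_indic.
  rewrite integral_indic// setIT.
  rewrite (_ : (_ * _)%E = (phi i * fine (P (c @^-1` [set i])))%:E); last first.
    by rewrite EFinM fineK// fin_num_measure.
  over.
by rewrite sumEFin.
Qed.

End finitely_valued.

(** * Integrals of bounded functions against a probability *)

Section bounded_integrals.
Context (d : measure_display) (T : measurableType d) (R : realType).
Variable P : probability T R.

Lemma integrable_of_bound (f : T -> R) (C : R) : measurable_fun setT f ->
  (forall t, `|f t| <= C) -> P.-integrable setT (EFin \o f).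
Proof.
move=> mf fC; apply: measurable_bounded_integrable => //.
  by rewrite ltey_eq fin_num_measure.
exists C; split; first exact: num_real.
by move=> D CD t _ /=; rewrite (le_trans (fC t))// ltW.
Qed.

Lemma integral_EFin_Rintegral (f : T -> R) (C : R) : measurable_fun setT f ->
  (forall t, `|f t| <= C) -> (\int[P]_t (f t)%:E)%E = (\int[P]_t f t)%:E.
Proof.
move=> mf fC; rewrite /Rintegral fineK//.
exact: (integrable_fin_num _ (@integrable_of_bound _ C mf fC)).
Qed.

(** Separates a uniform error [eta] from an error [K] carried by an exceptional set [S]. It serves
    with [K = 0] for the discretisation and with [K = C + C] for the set where the state is far from
    the target. *)
Lemma Rintegral_dist_le (f g : T -> R) (C eta K : R) (S : set T) :
  measurable_fun setT f -> measurable_fun setT g -> measurable S ->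
  (forall t, `|f t| <= C) -> (forall t, `|g t| <= C) ->
  (forall t, `|f t - g t| <= eta + K * \1_S t) ->
  `| \int[P]_t f t - \int[P]_t g t | <= eta + K * fine (P S).
Proof.
move=> mf mg mS fC gC fg.
have intf := @integrable_of_bound _ _ mf fC.
have intg := @integrable_of_bound _ _ mg gC.
have m1 : measurable_fun setT (\1_S : T -> R) by exact: measurable_indic.
have int1 : P.-integrable setT (EFin \o (\1_S : T -> R)).
  exact: integrable_indic.
rewrite -RintegralB//.
have intfg : P.-integrable setT (EFin \o (fun t => f t - g t)).
  apply: (@integrable_of_bound _ (C + C)); first exact: measurable_funB.
  by move=> t; rewrite (le_trans (ler_normB _ _))// lerD.
have inth : P.-integrable setT (EFin \o (fun t => eta + K * \1_S t)).
  apply: (@integrable_of_bound _ (`|eta| + `|K|)).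
    by apply: measurable_funD => //; exact: measurable_funM.
  move=> t; rewrite (le_trans (ler_normD _ _))// lerD// normrM.
  by rewrite ler_piMr// indicE; case: (_ \in _); rewrite ?normr0 ?normr1.
rewrite (le_trans (le_normr_Rintegral _ intfg))//.
rewrite (le_trans (le_Rintegral _ _ inth _))//.
  exact: integrable_norm.
have intc : P.-integrable setT (EFin \o (fun=> eta)).
  exact: (@integrable_of_bound _ `|eta|).
have intK : P.-integrable setT (EFin \o (fun t => K * \1_S t)).
  by have := integrableZl measurableT K int1; apply: eq_integrable.
have PT : fine (P setT) = 1 by rewrite probability_setT.
rewrite RintegralD// RintegralZl// Rintegral_cst//.
by rewrite [X in _ * X + _]PT mulr1 /Rintegral integral_indic// setIT.
Qed.

End bounded_integrals.

(** * Set functions that agree on measurable sets *)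

Import HBNNSimple.

(** The integral is a difference of suprema of integrals of simple functions, and those evaluate the
    set function only at measurable preimages; hence [mu] and [nu] may be bare set functions. *)
Lemma eq_integral_of_eq_measurable (d : measure_display) (T : measurableType d)
    (R : realType) (mu nu : set T -> \bar R) (f : T -> \bar R) :
  (forall A, measurable A -> mu A = nu A) ->
  (\int[mu]_t f t = \int[nu]_t f t)%E.
Proof.
move=> munu; rewrite /integral.
have E g : [set sintegral mu h | h in [set h : {nnsfun T >-> R} |
    forall t, ((h t)%:E <= g t)%E]] = [set sintegral nu h | h in
    [set h : {nnsfun T >-> R} | forall t, ((h t)%:E <= g t)%E]].
  apply: eq_imagel => h _.
  by rewrite /sintegral; apply: eq_fsbigr => r _; rewrite munu.
by congr (ereal_sup _ - ereal_sup _)%E; apply: E.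
Qed.

Lemma semi_sigma_additive_of_eq_measurable (d : measure_display)
    (T : measurableType d) (R : realType) (mu nu : set T -> \bar R) :
  (forall A, measurable A -> mu A = nu A) ->
  semi_sigma_additive mu -> semi_sigma_additive nu.
Proof.
move=> munu amu F mF tF mUF; rewrite -munu//.
rewrite (_ : (fun n => _) = (fun n => \sum_(0 <= i < n) mu (F i))%E).
  exact: amu.
by apply/funext => n; apply: eq_bigr => i _; rewrite munu.
Qed.

Section is_prob_probability.
Context (R : realType) (N : ptopologicalType).
Variable mu : set (borel N) -> \bar R.
Hypothesis pmu : is_prob mu.

(* [is_prob] constrains [mu] on Borel sets only, whereas a measure must be
   nonnegative on every set. *)
Let amu (A : set (borel N)) : \bar R := `|mu A|%E.

Let amuE A : measurable A -> mu A = amu A.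
Proof. by case: pmu => _ mu0 _ _ mA; rewrite /amu gee0_abs// mu0. Qed.

Let amu0 : amu set0 = 0%E.
Proof. by case: pmu => m0 _ _ _; rewrite -amuE. Qed.

Let amu_ge0 A : (0 <= amu A)%E.
Proof. exact: abse_ge0. Qed.

Let amu_sigma : semi_sigma_additive amu.
Proof.
by case: pmu => _ _ + _; apply: semi_sigma_additive_of_eq_measurable amuE.
Qed.

HB.instance Definition _ := isMeasure.Build _ _ _ amu amu0 amu_ge0 amu_sigma.

Let amuT : amu setT = 1%E.
Proof. by case: pmu => _ _ _ m1; rewrite -amuE. Qed.

HB.instance Definition _ := Measure_isProbability.Build _ _ _ amu amuT.

Lemma is_prob_probability :
  exists P : probability (borel N) R, forall A, measurable A -> mu A = P A.
Proof. by exists amu. Qed.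

End is_prob_probability.

(** * Borel measurability, and integrals against output measures *)

Lemma open_measurable_borel (T : ptopologicalType) (U : set T) :
  open U -> measurable (U : set (borel T)).
Proof. by move=> oU; exact: sub_sigma_algebra. Qed.

Section preimages_of_open.
Context (d : measure_display) (T : measurableType d) (X : topologicalType).
Variable x : T -> X.
Hypothesis mx : forall U, open U -> measurable (x @^-1` U).

Lemma measurable_fun_continuous_comp (R : realType) (g : X -> R) :
  continuous g -> measurable_fun setT (g \o x).
Proof.
move=> /continuousP cg.
apply: (measurability (RGenOInfty.G (R:=R))).
  exact: RGenOInfty.measurableE.
move=> _ [_ [a ->] <-]; rewrite setTI comp_preimage.
by apply: mx; apply: cg; exact: rray_open.
Qed.

Lemma measurable_fun_borel_comp (N : ptopologicalType) (h : X -> N) :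
  continuous h -> measurable_fun setT (h \o x : T -> borel N).
Proof.
move=> /continuousP ch.
apply: (@measurability _ _ T (borel N) setT (h \o x) (@open N)) => //.
by move=> _ [U oU <-]; rewrite setTI comp_preimage; apply/mx/ch.
Qed.

End preimages_of_open.

Lemma probability_setI_full (d : measure_display) (T : measurableType d)
    (R : realType) (P : probability T R) (D A : set T) :
  measurable D -> P D = 1%E -> measurable A -> P (D `&` A) = P A.
Proof.
move=> mD PD mA; have PDC : P (~` D) = 0%E.
  by rewrite probability_setC// PD subee.
have mDA : measurable (A `&` D) by exact: measurableI.
have mDCA : measurable (A `&` ~` D).
  by apply: measurableI => //; exact: measurableC.
have -> : P A = (P (A `&` D) + P (A `&` ~` D))%E.
  rewrite -measureU//; first by rewrite -setIUr setUv setIT.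
  by rewrite setIACA setICr setI0.
suff -> : P (A `&` ~` D) = 0%E by rewrite adde0 setIC.
apply/eqP; rewrite eq_le measure_ge0 andbT -PDC le_measure// inE//.
exact: measurableC.
Qed.

Section output_measures.
Context (R : realType) (d : nat) (M : topologicalType) (N : ptopologicalType).
Variables (lam : probability (borel 'rV[R]_d) R) (Om : set 'rV[R]_d).
Variables (h : M -> N) (x xt : 'rV[R]_d -> M).
Hypotheses (mOm : measurable (Om : set (borel 'rV[R]_d))).
Hypotheses (lamOm : lam Om = 1%E) (ch : continuous h).
Hypothesis xxt : forall b, Om b -> x b = xt b.
Hypothesis mxt : forall U, open U ->
  measurable (xt @^-1` U : set (borel 'rV[R]_d)).

Let mz : measurable_fun setT (h \o xt : borel 'rV[R]_d -> borel N).
Proof. exact: measurable_fun_borel_comp. Qed.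

(** A state is constrained only on [Om], so the pushforward is taken along a globally measurable
    [xt] agreeing with [x] there. What happens off [Om] is invisible because [Om] has full mass. *)
Lemma output_measureE (B : set (borel N)) : measurable B ->
  pushforward lam (h \o xt : borel 'rV[R]_d -> borel N) B =
  output_measure lam Om h x B.
Proof.
move=> mB; rewrite /output_measure /pushforward.
rewrite -(@probability_setI_full _ _ _ lam Om)//; last first.
  by rewrite -[X in measurable X]setTI; exact: mz.
congr (lam _); apply/seteqP; split=> b /= [Ob hb]; split=> //.
  by rewrite xxt.
by rewrite -xxt.
Qed.

Let mzf := isMeasurableFun.Build _ _ _ _ _ mz.
Let zf := MeasurableFun.Pack (MeasurableFun.Class mzf).

Lemma is_prob_output_measure : is_prob (output_measure lam Om h x).
Proof.
split.
- by rewrite /output_measure preimage_set0 setI0 measure0.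
- by move=> A _; rewrite /output_measure measure_ge0.
- apply: (semi_sigma_additive_of_eq_measurable output_measureE).
  exact: (@measure_semi_sigma_additive _ _ _ (pushforward lam zf)).
- by rewrite /output_measure preimage_setT setIT.
Qed.

Lemma integral_output_measure (f : N -> R) (C : R) : continuous f ->
  (forall y, `|f y| <= C) ->
  (\int[output_measure lam Om h x]_(y in setT) ((f y)%:E : \bar R))%E =
  (\int[lam]_b f (h (xt b)))%:E.
Proof.
move=> cf fC.
have mf : measurable_fun setT (f : borel N -> R).
  by apply: (@measurable_fun_continuous_comp _ (borel N) N id) => //;
     exact: open_measurable_borel.
have mfz : measurable_fun setT (fun b : borel 'rV[R]_d => f (h (xt b))).
  exact: (measurableT_comp mf mz).
rewrite -(@eq_integral_of_eq_measurable _ _ _ _ _ _ output_measureE).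
rewrite -(@integral_EFin_Rintegral _ _ _ lam _ C)//.
rewrite (@integral_pushforward _ _ _ _ _ zf)//.
- exact/measurable_EFinP.
- exact: (@integrable_of_bound _ _ _ lam _ C).
Qed.

End output_measures.

(** * Discretisation of a law with respect to finitely many bounded functions *)

Lemma finite_level_cells1 (d : measure_display) (T : measurableType d)
    (R : realType) (f : T -> R) (C eta : R) :
  measurable_fun setT f -> (forall t, `|f t| <= C) -> 0 < eta ->
  exists q : T -> 'I_(Num.truncn ((C + C) / eta)).+1,
    (forall i, measurable (q @^-1` [set i])) /\
    forall s t, q s = q t -> `|f s - f t| <= eta.
Proof.
(* Rescaling sends the range of [f] into the interval from 0 to [(C + C) / eta] and steps of size
   [eta] to unit steps, so the integer part of [v] is the cell index. The successor in the bound
   allows for the top index. *)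
move=> mf fC eta0; pose v t := (f t + C) / eta.
have fCC t : 0 <= f t + C <= C + C.
  by have := fC t; rewrite ler_norml => /andP[? ?]; apply/andP; split; lra.
have v0 t : 0 <= v t.
  by case/andP: (fCC t) => ? _; rewrite divr_ge0// ltW.
have vK t : (Num.truncn (v t) < (Num.truncn ((C + C) / eta)).+1)%N.
  rewrite ltnS le_truncn// ler_pM2r ?invr_gt0//.
  by case/andP: (fCC t).
exists (fun t => Ordinal (vK t)); split=> [i|s t []st].
  rewrite (_ : _ @^-1` _ = setT `&` v @^-1` `[i%:R, i.+1%:R[); last first.
    rewrite setTI; apply/seteqP; split=> t /=; rewrite in_itv/=.
      by move=> <-/=; exact: truncn_itv.
    by move=> /truncn_def vi; apply/val_inj.
  have mv : measurable_fun setT v.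
    by apply: measurable_funM => //; exact: measurable_funD.
  by apply: mv => //; exact: measurable_itv.
have := truncn_itv (v0 s); have := truncn_itv (v0 t); rewrite st -natr1.
set k := _%:R => /andP[t1 t2] /andP[s1 s2].
have -> : f s - f t = eta * (v s - v t).
  by rewrite /v -mulrBl mulrC divfK ?gt_eqF//; lra.
have vst : `|v s - v t| <= 1 by rewrite ler_norml; lra.
by rewrite normrM gtr0_norm// ler_piMr// ltW.
Qed.

Lemma finite_level_cells (d : measure_display) (T : measurableType d)
    (R : realType) (n : nat) (f : 'I_n -> T -> R) (C eta : R) :
  (forall i, measurable_fun setT (f i)) -> (forall i t, `|f i t| <= C) ->
  0 < eta ->
  exists (I : finType) (q : T -> I), (forall i, measurable (q @^-1` [set i])) /\
    forall s t, q s = q t -> forall i, `|f i s - f i t| <= eta.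
Proof.
move=> mf fC eta0.
have [q qP] := choice (fun i => @finite_level_cells1 _ _ _ _ _ _ (mf i) (fC i) eta0).
exists {ffun 'I_n -> 'I_(Num.truncn ((C + C) / eta)).+1}.
exists (fun t => [ffun i => q i t]); split=> [g|s t st i]; last first.
  by apply: (qP i).2; move/ffunP : st => /(_ i); rewrite !ffunE.
rewrite (_ : _ @^-1` _ = ~` \bigcup_(i in [set: 'I_n]) ~` (q i @^-1` [set g i])).
  apply: measurableC; apply: fin_bigcup_measurable => // i _.
  by apply: measurableC; exact: (qP i).1.
apply/seteqP; split=> t /=.
  by move=> <- [i _]; apply; rewrite /= ffunE.
move=> tg; apply/ffunP => i; rewrite ffunE; apply: contrapT => ti.
by apply: tg; exists i.
Qed.

(** Since [lam] is atomless, [c] can give each cell its [P]-mass. Then [y \o c] under [lam] has the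
    same law as [y \o q] under [P], and replacing [t] by the representative [y (q t)] of its cell
    moves each [f i] by at most [eta]. *)
Lemma approx_by_finite_map (d d' : measure_display) (T : measurableType d)
    (X : measurableType d') (R : realType) (lam : probability T R)
    (P : probability X R) (n : nat) (f : 'I_n -> X -> R) (C eta : R) :
  atomless lam ->
  (forall i, measurable_fun setT (f i)) -> (forall i t, `|f i t| <= C) ->
  0 < eta ->
  exists (I : finType) (c : T -> I) (y : I -> X),
    (forall g, measurable (c @^-1` [set g])) /\
    forall i, `| \int[lam]_b f i (y (c b)) - \int[P]_t f i t | <= eta.
Proof.
move=> atl mf fC eta0.
have [I [q [mq qP]]] := @finite_level_cells _ _ _ _ _ _ _ mf fC eta0.
pose w g := fine (P (q @^-1` [set g])).
have [g||c cP] := @atomless_partition _ _ _ lam _ w atl.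
- by rewrite /w fine_ge0.
- have := Rintegral_fin mq P (fun=> 1).
  rewrite Rintegral_cst// mul1r.
  have -> : fine (P setT) = 1 by rewrite probability_setT.
  by move=> ->; apply: eq_bigr => i _; rewrite mul1r.
(* An empty cell gets the default [point]; this is harmless because [y] is compared with [t] only at
   attained labels [q t]. *)
pose y g := xget point (q @^-1` [set g]).
have yP t : q (y (q t)) = q t.
  by apply: (@xgetPex _ point (q @^-1` [set q t])); exists t.
exists I, c, y; split=> [g|i]; first by case: (cP g).
have -> : \int[lam]_b f i (y (c b)) = \int[P]_t f i (y (q t)).
  have mc g : measurable (c @^-1` [set g]) by case: (cP g).
  rewrite (Rintegral_fin mc lam (f i \o y)) (Rintegral_fin mq P (f i \o y)).
  by apply: eq_bigr => g _; rewrite (cP g).2.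
rewrite (_ : eta = eta + 0 * fine (P set0)); last by rewrite mul0r addr0.
apply: (@Rintegral_dist_le _ _ _ P _ _ C) => //.
  exact: (@measurable_fun_fin _ _ _ q mq _ _ (fun g _ => f i (y g))).
by move=> t; rewrite mul0r addr0; exact: qP.
Qed.

(** * Continuity of the distance, and moduli of continuity at finitely many points *)

Lemma continuous_mdist (R : realType) (M : metricType R) (a : M) :
  continuous (fun m : M => mdist m a).
Proof.
move=> m; apply/cvgrPdist_lt => e e0.
near=> z.
have mz : mdist m z < e.
  near: z; have := nbhsx_ballx m e e0; by rewrite ballEmdist.
apply: le_lt_trans mz.
rewrite ler_norml; have := metric_triangle m z a; have := metric_triangle z m a.
by rewrite (metric_sym z m); lra.
Unshelve. all: by end_near. Qed.

Lemma continuous_mdist_ratio (R : realType) (M : metricType R) (a : M) :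
  continuous (fun m : M => mdist m a / (1 + mdist m a)).
Proof.
move=> m; apply: cvgM; first exact: continuous_mdist.
apply: cvgV; first by rewrite gt_eqF// ltr_pwDl// mdist_ge0.
by apply: cvgD; [exact: cvg_cst|exact: continuous_mdist].
Qed.

(** For a single pair of function and base point, every sufficiently small [delta] works. There are
    finitely many pairs, so these conditions hold together as [delta] tends to 0 from the right. *)
Lemma finite_modulus_of_continuity (R : realType) (M : metricType R)
    (I : finType) (n : nat) (g : 'I_n -> M -> R) (pt : I -> M) (eta : R) :
  (forall i, continuous (g i)) -> 0 < eta ->
  exists2 delta : R, 0 < delta & forall k i m, mdist m (pt k) < delta ->
    `|g i m - g i (pt k)| <= eta.
Proof.
move=> cg eta0.
have H (ki : I * 'I_n) : \forall delta \near 0^'+, forall m,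
    mdist m (pt ki.1) < delta -> `|g ki.2 m - g ki.2 (pt ki.1)| <= eta.
  have /cvgrPdist_le/(_ _ eta0) := cg ki.2 (pt ki.1).
  rewrite -nbhs_ballE => -[r /= r0 rP].
  near=> delta => m mdelta; rewrite distrC; apply: rP.
  rewrite ballEmdist/= metric_sym (lt_le_trans mdelta)//.
  by near: delta; exact: nbhs_right_le.
have [delta [d0 dP]] := filter_ex (filterI (nbhs_right_gt 0) (filter_forall _ H)).
by exists delta => // k i m; exact: (dP (k, i)).
Unshelve. all: by end_near. Qed.

Lemma uniform_bound_family (R : realType) (N : Type) (n : nat)
    (f : 'I_n -> N -> R) : (forall i, exists C, forall y, `|f i y| <= C) ->
  exists2 C : R, 0 <= C & forall i y, `|f i y| <= C.
Proof.
move=> /choice[C CP]; exists (\sum_i `|C i|); first by apply: sumr_ge0.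
move=> i y; rewrite (le_trans (CP i y))// (le_trans (ler_norm _))//.
by rewrite (bigD1 i)//= lerDl sumr_ge0.
Qed.

(** * States close to a finitely valued target *)

Section finitely_valued_target.
Context (R : realType) (d : nat) (M : metricType R).
Variables (lam : probability (borel 'rV[R]_d) R) (Om : set 'rV[R]_d).
Variables (I : finType) (c : 'rV[R]_d -> I) (pt : I -> M) (x : 'rV[R]_d -> M).
Hypothesis mOm : measurable (Om : set (borel 'rV[R]_d)).
Hypothesis mc : forall k, measurable (c @^-1` [set k] : set (borel 'rV[R]_d)).
Hypothesis mx : state_meas Om x.

Let xF b := pt (c b).

Lemma measurable_preimage_target (U : set M) :
  measurable (xF @^-1` U : set (borel 'rV[R]_d)).
Proof.
apply: (@measurable_preimage_fin _ (borel 'rV[R]_d) _ _ mc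
  (fun k => [set _ | U (pt k)])) => k.
have [Uk|nUk] := pselect (U (pt k)).
  by rewrite (_ : [set _ | _] = setT)//; apply/seteqP; split.
by rewrite (_ : [set _ | _] = set0)//; apply/seteqP; split.
Qed.

Lemma state_meas_target : state_meas Om xF.
Proof.
by move=> U _; apply: measurableI => //; exact: measurable_preimage_target.
Qed.

(** Makes the state measurable on the whole space. Choosing the target as the value off [Om] makes
    the distance to the target vanish there, so [far_set delta] lies in [Om] for positive
    [delta]. *)
Definition extend_state (b : 'rV[R]_d) : M := if b \in Om then x b else xF b.

Lemma extend_stateE b : Om b -> x b = extend_state b.
Proof. by move=> Ob; rewrite /extend_state mem_set. Qed.

Lemma measurable_preimage_extend_state (U : set M) : open U ->
  measurable (extend_state @^-1` U : set (borel 'rV[R]_d)).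
Proof.
move=> oU.
rewrite (_ : _ @^-1` _ = (Om `&` x @^-1` U) `|` (~` Om `&` xF @^-1` U)).
  apply: measurableU; first exact: mx.
  by apply: measurableI; [exact: measurableC|exact: measurable_preimage_target].
apply/seteqP; split=> b /=; rewrite /extend_state.
  by case: ifPn => [/set_mem|]; [left|rewrite notin_setE; right].
by case=> -[Ob Ub]; [rewrite mem_set|rewrite memNset].
Qed.

Definition far_set (delta : R) : set (borel 'rV[R]_d) :=
  [set b | delta <= mdist (extend_state b) (xF b)].

(** On each colour class the target is a constant [pt k], so the distance is there a continuous
    function of the state alone. *)
Lemma measurable_far_set (delta : R) : measurable (far_set delta).
Proof.
apply: (@measurable_preimage_fin _ (borel 'rV[R]_d) _ _ mc
  (fun k => [set b | delta <= mdist (extend_state b) (pt k)])) => k.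
rewrite (_ : [set _ | _] =
  setT `&` ((fun m => mdist m (pt k)) \o extend_state) @^-1` `[delta, +oo[).
  apply: (@measurable_fun_continuous_comp _ (borel 'rV[R]_d) M) => //.
    exact: measurable_preimage_extend_state.
  exact: continuous_mdist.
by rewrite setTI; apply/seteqP; split=> b /=; rewrite in_itv/= andbT.
Qed.

(** Markov's inequality: [s / (1 + s)] increases with [s], so the integrand of [dF] is at least
    [delta / (1 + delta)] on [far_set delta]. *)
Lemma markov_dF (delta : R) : 0 < delta ->
  ((delta / (1 + delta))%:E * lam (far_set delta) <= dF lam Om x xF)%E.
Proof.
move=> d0; set S := far_set delta.
have SOm : S `<=` Om.
  move=> b /=; apply: contraPP => nOb.
  by rewrite /S /far_set/= /extend_state memNset// mdistxx; apply/negP; rewrite -ltNge.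
have r0 : 0 <= delta / (1 + delta) by rewrite divr_ge0// ltW// ltr_pwDl// ltW.
have mS : measurable (S : set (borel 'rV[R]_d)) by exact: measurable_far_set.
rewrite /dF.
rewrite (eq_integral (fun b : borel 'rV[R]_d => (mdist (extend_state b) (xF b) /
    (1 + mdist (extend_state b) (xF b)))%:E)); last first.
  by move=> b; rewrite inE => Ob; rewrite -extend_stateE.
rewrite -[X in lam X](setIidl SOm) -integral_indic// -ge0_integralZl//; last first.
- exact/measurable_EFinP/measurable_indic.
apply: ge0_le_integral => //.
- by move=> b _; rewrite -EFinM lee_fin mulr_ge0.
- by apply/measurable_EFinP; apply: measurable_funM.
- apply/measurable_EFinP; apply: (@measurable_funS _ _ _ _ setT) => //.
  apply: (@measurable_fun_fin _ (borel 'rV[R]_d) _ _ mc _ _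
    (fun k b => mdist (extend_state b) (pt k) /
      (1 + mdist (extend_state b) (pt k)))) => k.
  apply: (@measurable_fun_continuous_comp _ (borel 'rV[R]_d) M extend_state
    _ _ (fun m => mdist m (pt k) / (1 + mdist m (pt k)))).
    exact: measurable_preimage_extend_state.
  exact: continuous_mdist_ratio.
move=> b _; rewrite -EFinM lee_fin indicE.
have [/set_mem Sb|_] := boolP (b \in S); last first.
  by rewrite mulr0 divr_ge0 ?addr_ge0 ?mdist_ge0.
rewrite mulr1; move: Sb; rewrite /S /far_set/=; set m := mdist _ _ => dm.
rewrite ler_pdivrMr; last lra.
rewrite mulrAC ler_pdivlMr; last lra.
lra.
Qed.

End finitely_valued_target.

(** * From ensemble controllability to pattern controllability *)

Unset Implicit Arguments.

Theorem theorem1 (R : realType) (d p : nat)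
  (Om : set 'rV[R]_d) (lam : probability (borel 'rV[R]_d) R)
  (M : metricType R) (N : pseudoPMetricType R) (h : M -> N)
  (dP : (set (borel N) -> \bar R) -> (set (borel N) -> \bar R) -> R)
  (sol : ('rV[R]_d -> M) -> (R -> 'rV[R]_p) -> R -> ('rV[R]_d -> M)) :
  compact Om ->
  lam Om = 1%E ->
  atomless lam ->
  sigma_compact M ->
  polish_metric N ->
  metrizes_weak dP ->
  (forall (x0 : 'rV[R]_d -> M) (u : R -> 'rV[R]_p) (T : R),
      state_meas Om x0 -> 0 < T -> control_meas T u ->
      state_meas Om (sol x0 u T)) ->
  ensemble_controllable lam Om sol ->
  continuous h ->
  (forall y : N, exists x : M, h x = y) ->
  pattern_controllable lam Om h dP sol.
Proof.
move=> cOm lamOm atl scM polN [[dP0 dPxx dPeq dPsym dPtri] dPweak] solM ec ch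
  sh x0 mx0 muF pmuF eps eps0.
(* [Om] is its own intersection with the preimage of all of [M] under the measurable state [x0]. *)
have mOm : measurable (Om : set (borel 'rV[R]_d)).
  by have := mx0 setT openT; rewrite preimage_setT setIT.
(* This [dP]-ball is open for [dP] by the triangle inequality, hence weakly open, which reduces the
   goal to finitely many integral tests with tolerance [e]. *)
pose U := [set nu | is_prob nu /\ dP muF nu < eps].
have oU : weak_open U.
  apply/dPweak; first by move=> nu [].
  move=> mu [pmu multe]; exists (eps - dP muF mu); split.
    by rewrite subr_gt0.
  move=> nu pnu munu; split => //.
  by rewrite (le_lt_trans (dPtri _ _ _ pmuF pmu pnu))// -ltrBrDl.
have [|n [f [e [e0 fP fU]]]] := oU muF pmuF.
  by split => //; rewrite dPxx.
have [C C0 fC] := uniform_bound_family (fun i => (fP i).2).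
have mf i : measurable_fun setT (f i : borel N -> R).
  by apply: (@measurable_fun_continuous_comp _ (borel N) N id) => //;
     [exact: open_measurable_borel|exact: (fP i).1].
have [P PmuF] := is_prob_probability pmuF.
(* Three errors share the tolerance: discretising [muF], the modulus of continuity near the target,
   and the exceptional set. Each is at most [e / 4], leaving a strict margin. *)
have eta0 : 0 < e / 4 by rewrite divr_gt0.
have [I [c [y [mc cP]]]] := approx_by_finite_map P atl mf fC eta0.
have [pt ptP] := choice (fun k => sh (y k)).
have cfh i : continuous (f i \o h).
  by move=> m; apply: continuous_comp; [exact: ch|exact: (fP i).1].
have [delta delta0 deltaP] := finite_modulus_of_continuity pt cfh eta0.
pose xF b := pt (c b).
have mxF : state_meas Om xF by exact: state_meas_target.
pose r := delta / (1 + delta).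
have r0 : 0 < r by rewrite divr_gt0// addr_gt0.
(* Asking for [dF] below [r] times this constant makes Markov's inequality bound the mass of the
   exceptional set by the constant, so that [C + C] times the mass is at most [e / 4]. The added 1
   keeps the divisor positive when [C] is 0. *)
have K0 : 0 < e / 4 / (C + C + 1).
  by rewrite divr_gt0// ltr_pwDr// addr_ge0.
have [T [u [T0 mu dFlt]]] := ec x0 xF mx0 mxF _ (mulr_gt0 r0 K0).
exists T, u; split => //; set x := sol x0 u T in dFlt *.
have mx : state_meas Om x by exact: solM.
pose xt := extend_state Om c pt x.
have xxt : forall b, Om b -> x b = xt b by exact: extend_stateE.
have mxt V : open V -> measurable (xt @^-1` V : set (borel 'rV[R]_d)).
  exact: measurable_preimage_extend_state.
have pout : is_prob (output_measure lam Om h x).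
  exact: (is_prob_output_measure mOm lamOm ch xxt mxt).
rewrite dPsym//; suff [] : U (output_measure lam Om h x) by [].
apply: fU => // i.
rewrite (integral_output_measure mOm lamOm ch xxt mxt (fP i).1 (fC i)).
rewrite (eq_integral_of_eq_measurable _ PmuF).
rewrite (integral_EFin_Rintegral P (mf i) (fC i)) -EFinB/= lte_fin.
pose S := far_set Om c pt x delta.
have mS : measurable S by exact: measurable_far_set.
have PS : fine (lam S) < e / 4 / (C + C + 1).
  rewrite -(ltr_pM2l r0) -lte_fin EFinM fineK ?fin_num_measure//.
  by apply: le_lt_trans dFlt; exact: markov_dF.
have far : `| \int[lam]_b f i (h (xt b)) - \int[lam]_b f i (h (xF b)) | <=
    e / 4 + (C + C) * fine (lam S).
  apply: (@Rintegral_dist_le _ (borel 'rV[R]_d) R lam _ _ C) => //.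
  - exact: (@measurable_fun_continuous_comp _ (borel 'rV[R]_d) M xt mxt _ _ (cfh i)).
  - apply: (@measurable_fun_continuous_comp _ (borel 'rV[R]_d) M xF _ _ _ (cfh i)).
    by move=> V _; exact: measurable_preimage_target.
  move=> b; rewrite indicE; have [Sb|nSb] := boolP (b \in S).
    rewrite mulr1 (le_trans (ler_normB _ _))//.
    have := fC i (h (xt b)); have := fC i (h (xF b)); lra.
  rewrite mulr0 addr0; apply: deltaP.
  by move: nSb; rewrite notin_setE /S /far_set/= => /negP; rewrite -ltNge.
have near : `| \int[lam]_b f i (h (xF b)) - \int[P]_t f i t | <= e / 4.
  have -> : \int[lam]_b f i (h (xF b)) = \int[lam]_b f i (y (c b)).
    by apply: eq_Rintegral => b _; rewrite /xF ptP.
  exact: cP.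
have small : (C + C) * fine (lam S) <= e / 4.
  have C1 : 0 < C + C + 1 by lra.
  rewrite ltr_pdivlMr// in PS.
  have := fine_ge0 (measure_ge0 lam S); nra.
by move: far near; rewrite !ler_norml ltr_norml; lra.
Qed.
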